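(* Let $p,s\in\mathbb{C}$. Then $(0,0,p,s)\in\mathbb{F}$ if and only if $(s,-p)\in\mathbb{G}_2$.
   Context: $M_2(\mathbb{C})$ is the space of $2\times 2$ complex matrices and $\|A\|$ is the operator norm of $A$. The domain $\mathbb{F}$ is \[ \mathbb{F}=\{(a_{11},a_{22},\det(A),a_{12}+a_{21})\in\mathbb{C}^4 : A=(a_{ij})_{i,j=1}^2\in M_2(\mathbb{C}),\ \|A\|<1\}. \] The symmetrized bidisc is $\mathbb{G}_2=\{(z_1+z_2,z_1z_2)\in\mathbb{C}^2 : |z_1|<1,\ |z_2|<1\}$. *)

(* Defs.v *)
From mathcomp Require Import all_boot all_order all_algebra.
From mathcomp Require Import classical_sets reals complex.

Set Implicit Arguments.
Unset Strict Implicit.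
Unset Printing Implicit Defensive.

Import Order.TTheory GRing.Theory Num.Theory.

Local Open Scope ring_scope.
Local Open Scope classical_set_scope.

(* [normc z] is the modulus of [z] as an element of [R]; [`|z|] is the same
   number as an element of [R[i]]. *)
Definition l2norm (R : realType) (n : nat) (x : 'cV[R[i]]_n) : R :=
  Num.sqrt (\sum_(i < n) ComplexField.Normc.normc (x i 0) ^+ 2).

Definition opnorm (R : realType) (m n : nat) (A : 'M[R[i]]_(m, n)) : R :=
  sup [set l2norm (A *m x) | x in [set x : 'cV[R[i]]_n | l2norm x <= 1]].

Definition domainF (R : realType) : set (R[i] * R[i] * R[i] * R[i]) :=
  [set (A 0 0, A 1 1, \det A, A 0 1 + A 1 0)
     | A in [set A : 'M[R[i]]_2 | opnorm A < 1]].

Definition symmetrized_bidisc (R : realType) : set (R[i] * R[i]) :=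
  [set (z.1 + z.2, z.1 * z.2)
     | z in [set z : R[i] * R[i] | `|z.1| < 1 /\ `|z.2| < 1]].

Arguments domainF R : clear implicits.
Arguments symmetrized_bidisc R : clear implicits.

(* Main.v *)
Require Import Defs.
From mathcomp Require Import all_boot all_order all_algebra.
From mathcomp Require Import classical_sets reals complex.

Import Order.TTheory GRing.Theory Num.Theory.

Local Open Scope ring_scope.
Local Open Scope classical_set_scope.

(** A point of the domain with vanishing first two coordinates comes from an
    antidiagonal matrix with entries [b, c], for which [s = b + c] and
    [- p = b * c].  Since [A (x, y) = (b y, c x)], the operator norm of such a
    matrix is [max (|b|, |c|)]. *)

Local Notation normc := ComplexField.Normc.normc.

(** The bidisc compares moduli inside [R[i]], whereas [opnorm] takes its values in [R]; this moves
    the strict bound from one side to the other. *)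
Lemma normc_lt1 (R : realType) (z : R[i]) : (`|z| < 1) = (normc z < 1).
Proof. by rewrite normc_def; case: z => a b /=; rewrite -(ltcR _ 1). Qed.

Lemma normc_ge0 (R : realType) (z : R[i]) : 0 <= normc z.
Proof. by case: z => a b; exact: sqrtr_ge0. Qed.

Lemma l2norm_delta (R : realType) (n : nat) (i : 'I_n) :
  l2norm (delta_mx i 0 : 'cV[R[i]]_n) = 1.
Proof.
rewrite /l2norm (bigD1 i) //= big1 => [|j /negPf ji].
  by rewrite mxE !eqxx ComplexField.Normc.normc1 expr1n addr0 sqrtr1.
by rewrite mxE ji ComplexField.Normc.normc0 expr0n.
Qed.

Lemma l2norm2E (R : realType) (x : 'cV[R[i]]_2) :
  l2norm x = Num.sqrt (normc (x 0 0) ^+ 2 + normc (x 1 0) ^+ 2).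
Proof.
rewrite /l2norm big_ord_recl big_ord1.
by congr (Num.sqrt (_ + normc (x _ 0) ^+ 2)); apply: val_inj.
Qed.

Section Antidiagonal.
Variables (R : realType) (A : 'M[R[i]]_2).
Hypotheses (A00 : A 0 0 = 0) (A11 : A 1 1 = 0).

Let M := Num.max (normc (A 0 1)) (normc (A 1 0)).

Lemma lift0_ord1 : lift ord0 (ord0 : 'I_1) = 1 :> 'I_2.
Proof. exact: val_inj. Qed.

Lemma det_antidiag : \det A = - (A 0 1 * A 1 0).
Proof.
rewrite (expand_det_row _ 0) !big_ord_recl big_ord0 lift0_ord1 A00.
by rewrite mul0r add0r addr0 /cofactor det_mx11 !mxE expr1 mulN1r mulrN
           lift0_ord1; congr (- (_ * A _ _)); apply: val_inj.
Qed.

Lemma l2norm_antidiag (x : 'cV[R[i]]_2) :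
  l2norm (A *m x) =
  Num.sqrt ((normc (A 0 1) * normc (x 1 0)) ^+ 2
            + (normc (A 1 0) * normc (x 0 0)) ^+ 2).
Proof.
rewrite l2norm2E !mxE !big_ord_recl !big_ord0 !lift0_ord1 A00 A11.
by rewrite !mul0r !addr0 add0r !ComplexField.Normc.normcM.
Qed.

Lemma l2norm_antidiag_le (x : 'cV[R[i]]_2) :
  l2norm x <= 1 -> l2norm (A *m x) <= M.
Proof.
have M0 : 0 <= M by rewrite le_max normc_ge0.
rewrite l2norm2E l2norm_antidiag -{1}sqrtr1 ler_psqrt ?nnegrE ?ler01 //; last first.
  by rewrite addr_ge0 ?sqr_ge0.
(* Since [M] is nonnegative it is the square root of [M ^+ 2], so it suffices to compare the
   radicands. *)
move=> x1; rewrite -[leRHS]ger0_norm // -sqrtr_sqr ler_wsqrtr //.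
(* The intermediate bound is [M ^+ 2] times the squared norm of [x]. The sum is then reordered,
   because [A] exchanges the coordinates, and compared term by term. *)
apply: (le_trans _ (ler_piMr (sqr_ge0 M) x1)).
rewrite mulrDr addrC !exprMn lerD // ler_wpM2r ?sqr_ge0 //.
  by rewrite ler_sqr ?nnegrE ?normc_ge0 // le_max lexx orbT.
by rewrite ler_sqr ?nnegrE ?normc_ge0 // le_max lexx.
Qed.

(** The bound [M] is attained at a standard basis vector: the two of them are sent to vectors of
    norm [normc (A 1 0)] and [normc (A 0 1)]. *)
Lemma opnorm_antidiag : opnorm A = M.
Proof.
apply/eqP; rewrite eq_le; apply/andP; split.
  apply: ge_sup => [|_ [x /= x1 <-]]; last exact: l2norm_antidiag_le.
  (* Bounding a [sup] from above requires a nonempty set; the zero vector lies in the unit ball. *)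
  exists (l2norm (A *m 0)), 0 => //=.
  by rewrite l2norm2E !mxE ComplexField.Normc.normc0 expr0n addr0 sqrtr0 ler01.
(* A [sup] is known to dominate its set only once the set is bounded above; here [M] is such a
   bound. *)
have ub (x : 'cV[R[i]]_2) : l2norm x <= 1 -> l2norm (A *m x) <= opnorm A.
  move=> x1; apply: ub_le_sup; last by exists x.
  by exists M => _ [y /= y1 <-]; exact: l2norm_antidiag_le.
have e0 : l2norm (A *m delta_mx 1 0) = normc (A 0 1).
  rewrite l2norm_antidiag !mxE !eqxx ComplexField.Normc.normc0.
  by rewrite ComplexField.Normc.normc1 mulr1 mulr0 expr0n addr0 sqrtr_sqr
             ger0_norm ?normc_ge0.
have e1 : l2norm (A *m delta_mx 0 0) = normc (A 1 0).
  rewrite l2norm_antidiag !mxE !eqxx ComplexField.Normc.normc0.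
  by rewrite ComplexField.Normc.normc1 mulr1 mulr0 expr0n add0r sqrtr_sqr
             ger0_norm ?normc_ge0.
by rewrite ge_max -{1}e0 -{1}e1 !ub ?l2norm_delta.
Qed.

Lemma opnorm_antidiag_lt1 : (opnorm A < 1) = (`|A 0 1| < 1) && (`|A 1 0| < 1).
Proof. by rewrite opnorm_antidiag gt_max !normc_lt1. Qed.

End Antidiagonal.

Theorem proposition2p14 (R : realType) (p s : R[i]) :
  domainF R (0, 0, p, s) <-> symmetrized_bidisc R (s, - p).
Proof.
split=> [[A /= A1 [A00 A11 <- <-]]|[[b c] /= [b1 c1] [<- bcp]]].
  move: A1; rewrite opnorm_antidiag_lt1 // => /andP[b1 c1].
  by exists (A 0 1, A 1 0); rewrite //= det_antidiag ?opprK.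
(* With [b] and [c] off the diagonal, the determinant is [- (b * c)], which [bcp] turns into [p]. *)
pose A : 'M[R[i]]_2 :=
  \matrix_(i, j) if i == j then 0 else if i == 0 then b else c.
have A00 : A 0 0 = 0 by rewrite mxE.
have A11 : A 1 1 = 0 by rewrite mxE.
have A01 : A 0 1 = b by rewrite mxE.
have A10 : A 1 0 = c by rewrite mxE.
exists A; first by rewrite /= opnorm_antidiag_lt1 // A01 A10 b1.
by rewrite det_antidiag // A00 A11 A01 A10 bcp opprK.
Qed.
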